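(* Let $p \ge 7$ be a prime. The following four conditions are equivalent: (a) $\binom{2p-1}{p-1} \equiv 1 \pmod{p^5}$; (b) $1+\frac{1}{2}+\frac{1}{3}+\cdots+\frac{1}{p-1} \equiv 0 \pmod{p^4}$; (c) $1+\frac{1}{2^2}+\frac{1}{3^2}+\cdots+\frac{1}{(p-1)^2} \equiv 0 \pmod{p^3}$; (d) $p^2 \mid B_{p^3-p^2-2}$, where $B_k$ denotes the $k$-th Bernoulli number.
   Context: In (b) and (c), $\frac{1}{k}$ (resp. $\frac{1}{k^2}$) for $1\le k\le p-1$ denotes the multiplicative inverse of $k$ (resp. $k^2$) modulo the relevant prime power ($p^4$ in (b), $p^3$ in (c)); equivalently, the congruences can be read for the rational sums, whose denominators are prime to $p$. The Bernoulli numbers $B_k$ are the rational numbers defined by $\frac{t}{e^t-1}=\sum_{k\ge 0} B_k \frac{t^k}{k!}$. For a rational number $x$ whose denominator is prime to $p$, $p^2 \mid x$ means that the numerator of $x$ (in lowest terms) is divisible by $p^2$. *)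

(* Defs.v *)
From HB Require Import structures.
From mathcomp Require Import all_boot all_order all_algebra.

Set Implicit Arguments.
Unset Strict Implicit.
Unset Printing Implicit Defensive.

Import GRing.Theory.
Local Open Scope ring_scope.

(* A sequence f : nat -> rat stands for the formal power series
   \sum_n f n t^n in Q[[t]]; fps_mul is the Cauchy product. *)
Definition fps_mul (f g : nat -> rat) (n : nat) : rat :=
  \sum_(i < n.+1) f i * g (n - i)%N.

Definition fps_one (n : nat) : rat := (n == 0%N)%:R.

Definition fps_t (n : nat) : rat := (n == 1%N)%:R.

Definition fps_exp (n : nat) : rat := n`!%:R^-1.

(* The identity t / (e^t - 1) = \sum_k B_k t^k / k!, with the denominator
   cleared: e^t - 1 has zero constant term, hence no inverse in Q[[t]], but
   Q[[t]] is a domain, so the identity determines B (bernoulli_unique). *)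
Definition bernoulli_gf (B : nat -> rat) : Prop :=
  forall n : nat,
    fps_mul (fun k => B k / k`!%:R) (fun k => fps_exp k - fps_one k) n
    = fps_t n.

Lemma bernoulli_gfS (B : nat -> rat) (m : nat) :
  fps_mul (fun k => B k / k`!%:R) (fun k => fps_exp k - fps_one k) m.+1
  = \sum_(i < m) B i / i`!%:R / (m.+1 - i)`!%:R + B m / m`!%:R.
Proof.
rewrite /fps_mul 2!big_ord_recr /= subnn subSnn /fps_exp /fps_one /= !fact0.
rewrite invr1 subrr mulr0 addr0 subr0 mulr1; congr (_ + _).
apply: eq_bigr => i _; rewrite subSn; last exact: ltnW.
by rewrite /= subr0.
Qed.

Lemma fact_ratr_neq0 (n : nat) : n`!%:R != 0 :> rat.
Proof. by rewrite Num.Theory.pnatr_eq0 -lt0n fact_gt0. Qed.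

Lemma bernoulli_unique (B B' : nat -> rat) :
  bernoulli_gf B -> bernoulli_gf B' -> B =1 B'.
Proof.
move=> hB hB' n; elim/ltn_ind: n => n IHn.
have := hB n.+1; rewrite -(hB' n.+1) !bernoulli_gfS.
rewrite (eq_bigr (fun i : 'I_n => B' i / i`!%:R / (n.+1 - i)`!%:R)); last first.
  by move=> i _; rewrite IHn.
by move/addrI/mulIf => -> //; rewrite invr_eq0 fact_ratr_neq0.
Qed.

Lemma bernoulli_exists : {B : nat -> rat | bernoulli_gf B}.
Proof.
pose next (s : seq rat) : rat := (size s == 0%N)%:R
  - \sum_(i < size s) s`_i / ((size s).+1 - i)`!%:R.
pose l n := iter n (fun s => rcons s (next s)) [::].
have szl n : size (l n) = n by elim: n => //= n IHn; rewrite size_rcons IHn.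
have nthl n i : (i < n)%N -> (l n)`_i = next (l i).
  elim: n => //= n IHn; rewrite ltnS nth_rcons szl leq_eqVlt.
  by case/predU1P=> [->|lt_in]; rewrite ?ltnn ?eqxx // lt_in IHn.
exists (fun n => next (l n) * n`!%:R) => -[|m].
  by rewrite /fps_mul big_ord1 /fps_exp /fps_one /= invr1 subrr mulr0.
rewrite bernoulli_gfS mulfK ?fact_ratr_neq0 //.
rewrite (eq_bigr (fun i : 'I_m => (l m)`_i / (m.+1 - i)`!%:R)); last first.
  by move=> i _; rewrite mulfK ?fact_ratr_neq0 // nthl.
by rewrite /next szl addrC subrK /fps_t eqSS.
Qed.

Definition bernoulli : nat -> rat := sval bernoulli_exists.

Lemma bernoulliP : bernoulli_gf bernoulli.
Proof. exact: svalP bernoulli_exists. Qed.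

(* Main.v *)
(* Let f = (X + 1)...(X + p - 1), with coefficients a_i; p divides a_i for
   0 < i < p - 1. The symmetry f(- p - X) = f gives p^2 | a_3, and then f(-p) = a_0
   reads a_1 = p a_2 (mod p^4), while f(p) = C(2p - 1, p - 1) a_0 gives
   (C(2p - 1, p - 1) - 1) a_0 = 2 p a_1 (mod p^5). Since a_1 / a_0 is the harmonic
   sum and a_1^2 - 2 a_0 a_2 = a_0^2 \sum 1/k^2, conditions (a), (b), (c) amount
   to p^4 | a_1, p^4 | a_1 and p^3 | a_2, which are equivalent.
   For (d) let m = p^3 - p^2 - 2. By Euler \sum 1/k^2 = \sum k^m (mod p^3), and in
   the Bernoulli formula for \sum k^m every term but p B_m vanishes mod p^3: the
   numbers p B_k are p-integral, and B_(m - 2) and B_(m - 1) / p are p-integral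
   because p | \sum k^(m - 2) and p^2 | \sum k^(m - 1). *)
Require Import Defs.
From mathcomp Require Import all_boot all_order all_algebra all_field all_solvable.
From mathcomp Require Import ring zify.

Import GRing.Theory Num.Theory.
Local Open Scope ring_scope.

(** * The polynomial (X + 1)...(X + p - 1) and the divisibility of its coefficients *)

Definition rising {R : nzRingType} (p : nat) : {poly R} :=
  \prod_(1 <= j < p) ('X + j%:R%:P).

Lemma map_rising (R S : nzRingType) (h : {rmorphism R -> S}) (p : nat) :
  map_poly h (rising p) = rising p.
Proof.
rewrite /rising rmorph_prod; apply: eq_bigr => j _.
by rewrite rmorphD /= map_polyX map_polyC /= rmorph_nat.
Qed.

(** The substitution sends X + j to -(X + p - j), so it permutes the factors up to sign; their
    number p - 1 is even, and the signs cancel. *)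
Lemma rising_comp (R : comNzRingType) (p : nat) : odd p ->
  rising p \Po (- 'X - p%:R%:P) = rising p :> {poly R}.
Proof.
move=> p_odd; have p_gt0 := odd_gt0 p_odd.
rewrite /rising (big_morph (fun q => q \Po _) (fun _ _ => comp_polyM _ _ _) (comp_polyC _ _)).
rewrite big_nat_rev /=.
rewrite (eq_big_nat _ _ (F2 := fun j => (-1) * ('X + j%:R%:P : {poly R}))); last first.
  move=> j /andP[j_gt0 lt_jp].
  rewrite comp_polyD comp_polyX comp_polyC !polyC_natr add1n subSS natrB ?(ltnW lt_jp) //.
  ring.
rewrite big_split /= big_const_nat iter_mulr_1 -signr_odd subn1.
by case: p p_odd {p_gt0} => //= p /negbTE->; rewrite mul1r.
Qed.

(** Over F_p, X^p - X is the product of all X - x; writing the nonzero x as -j and cancelling X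
    leaves [rising p]. *)
Lemma rising_Fp (p : nat) : prime p -> rising p = 'X^(p.-1) - 1 :> {poly 'F_p}.
Proof.
move=> p_pr; have p_gt0 := prime_gt0 p_pr.
have pE : (Zp_trunc (pdiv p)).+2 = p by exact: Fp_cast.
have /esym := finField_genPoly 'F_p; rewrite card_Fp //.
rewrite (eq_bigr (fun x : 'I_(Zp_trunc (pdiv p)).+2 => 'X - (x : nat)%:R%:P)); last first.
  by move=> x _; rewrite natr_Zp.
pose F (j : nat) : {poly 'F_p} := 'X - j%:R%:P.
rewrite -(big_mkord xpredT F) pE big_ltn // {1}/F polyC0 subr0 big_nat_rev /=.
rewrite (eq_big_nat _ _ (F2 := fun j => 'X + j%:R%:P)); last first.
  move=> j /andP[j_gt0 lt_jp].
  by rewrite /F add1n subSS natrB ?(ltnW lt_jp) // pchar_Fp_0 // sub0r polyCN opprK.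
rewrite -/(rising p); have -> : 'X^p = 'X * 'X^(p.-1) :> {poly 'F_p} by rewrite -exprS prednK.
rewrite -[X in _ - X](mulr1 'X) -mulrBr.
by apply: mulfI; rewrite polyX_eq0.
Qed.

(** Vieta and Newton for the inverses: a_1 / a_0 is their sum, and 2 a_2 / a_0 is the square of that
    sum minus the sum of their squares. With denominators cleared, induction on the factors works
    even with zero divisors, as in Z/p^e. *)
Lemma coef_prod_inv (R : comUnitRingType) (I : Type) (s : seq I) (P : pred I) (u : I -> R) :
  (forall i, P i -> u i \is a GRing.unit) ->
  let f := \prod_(i <- s | P i) ('X + (u i)%:P) in
  [/\ f`_0 = \prod_(i <- s | P i) u i,
      f`_1 = f`_0 * \sum_(i <- s | P i) (u i)^-1 &
      f`_1 ^+ 2 - 2%:R * f`_0 * f`_2 = f`_0 ^+ 2 * \sum_(i <- s | P i) (u i ^+ 2)^-1].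
Proof.
move=> uU f; rewrite {}/f; elim: s => [|i s [IH0 IH1 IH2]].
  by rewrite !big_nil !coefC /= !mulr0 expr0n subr0; split.
rewrite !big_cons; case: ifP => // Pi.
move: IH0 IH1 IH2; set f := \prod_(j <- s | P j) ('X + (u j)%:P) => IH0 IH1 IH2.
rewrite mulrDl !coefD !coefXM /= !coefCM -IH0 add0r.
have uV : u i * (u i)^-1 = 1 by rewrite divrr ?uU.
have uV2 : u i ^+ 2 * (u i ^+ 2)^-1 = 1 by rewrite divrr // unitrX ?uU.
split=> //.
  by rewrite IH1 mulrDr mulrAC uV mul1r; ring.
set S1 := \sum_(_ <- _ | _) _ in IH1 *; set S2 := \sum_(_ <- _ | _) _ in IH2 *.
(* Multiplying f by X + u turns f_1^2 - 2 f_0 f_2 into f_0^2 + u^2 (f_1^2 - 2 f_0 f_2): the terms 2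
   u f_0 f_1 cancel. *)
transitivity (f`_0 ^+ 2 + u i ^+ 2 * (f`_1 ^+ 2 - 2%:R * f`_0 * f`_2)); first ring.
rewrite IH2 mulrDr exprMn [X in _ = X + _]mulrAC uV2; ring.
Qed.

(** The bound on m matters: ['Z_0] and ['Z_1] both have two elements. *)
Lemma intr_Zp_eq0 (m : nat) (z : int) : (1 < m)%N ->
  (z%:~R == 0 :> 'Z_m) = (m %| z)%Z.
Proof.
move=> m_gt1; have natE n : (n%:R == 0 :> 'Z_m) = (m %| n)%N.
  by rewrite -val_eqE /= val_Zp_nat.
by case: z => n; rewrite dvdzE ?NegzE ?mulrNz ?oppr_eq0 -pmulrn natE.
Qed.

Lemma rising_coef_dvd (p i : nat) : prime p -> (0 < i < p.-1)%N ->
  (p %| (rising p : {poly int})`_i)%Z.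
Proof.
move=> p_pr /andP[i_gt0 lt_ip]; have p_gt1 := prime_gt1 p_pr.
have <- : (((rising p : {poly int})`_i)%:~R == 0 :> 'F_p) =
    (p %| (rising p : {poly int})`_i)%Z.
  by rewrite intr_Zp_eq0 pdiv_id.
have /(congr1 (fun f : {poly 'F_p} => f`_i)) := rising_Fp p p_pr.
rewrite -(map_rising int 'F_p intr) coef_map /= => ->.
by rewrite coefB coefXn coefC ltn_eqF // gtn_eqF // subrr.
Qed.

Lemma horner_drop (R : comNzRingType) (n : nat) (f : {poly R}) (x : R) :
  f.[x] = \sum_(i < n) f`_i * x ^+ i + (drop_poly n f).[x] * x ^+ n.
Proof.
rewrite -{1}(poly_take_drop n f) hornerD hornerM hornerXn; congr (_ + _).
rewrite (horner_coef_wide _ (size_take_poly _ _)); apply: eq_bigr => i _.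
by rewrite coef_take_poly ltn_ord.
Qed.

Lemma prime_ge7_odd (p : nat) : prime p -> (7 <= p)%N -> odd p.
Proof. by case/even_prime => // ->. Qed.

(** The third derivative of f = f(-p - X) at 0 gives 6 a_3 = -6 a_3 + 24 p a_4 (mod p^2), where p |
    a_4; and 12 is prime to p. *)
Lemma rising_coef3_dvd (p : nat) : prime p -> (7 <= p)%N ->
  (p%:Z ^+ 2 %| (rising p : {poly int})`_3)%Z.
Proof.
move=> p_pr p_ge7; have p_odd := prime_ge7_odd p p_pr p_ge7.
set f : {poly int} := rising p; pose q : {poly int} := - 'X - p%:R%:P.
have dq : q^`() = -1 by rewrite derivB derivN derivX derivC subr0.
have fq : f = f \Po q by rewrite rising_comp.
have f1q : f^`() = - (f^`() \Po q) by rewrite {1}fq deriv_comp dq mulrN1.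
have f2q : f^`()^`() = f^`()^`() \Po q.
  by rewrite {1}f1q derivN deriv_comp dq mulrN1 opprK.
have f3q : f^`()^`()^`() = - (f^`()^`()^`() \Po q).
  by rewrite {1}f2q deriv_comp dq mulrN1.
have /(congr1 (fun g => g.[0])) := f3q.
rewrite hornerN horner_comp /q !hornerE horner_coef0.
rewrite (horner_drop _ 2) !big_ord_recr big_ord0 /= !coef_deriv.
have /dvdzP[c ->] : (p %| f`_4)%Z by apply: rising_coef_dvd => //; lia.
set r := _.[_] => e3.
rewrite !natz expr0 expr1 sqrrN add0r !mulr1 in e3.
have e : 12 * f`_3 = (24 * c - r) * p%:Z ^+ 2.
  move: e3; set P := p%:Z; set y := f`_3 => e3.
  (* Three derivatives leave 3! a_3 as nested multiples. *)
  transitivity (y *+ 3 *+ 2 *+ 1 + 6 * y); first ring.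
  by rewrite e3; ring.
have cop : coprimez (p%:Z ^+ 2) 12.
  apply: coprimezXl; rewrite coprimezE (_ : `|_|%N = p) ?prime_coprime //.
  apply/negP; rewrite -[`|_|%N]/(2 * 2 * 3)%N !Euclid_dvdM // -orbA.
  by case/or3P => /dvdn_leq => /(_ isT); lia.
by rewrite -(Gauss_dvdzr _ cop) e dvdz_mull.
Qed.

(** * Values at 0, p and -p, and the resulting relations between coefficients *)

Lemma rising_coef0 (R : comNzRingType) (p : nat) :
  (rising p : {poly R})`_0 = (p.-1)`!%:R.
Proof.
rewrite -horner_coef0 /rising horner_prod fact_prod natr_prod.
case: p => [|p]; first by rewrite !big_geq.
by apply: eq_bigr => j _; rewrite !hornerE.
Qed.

(** The value is (p + 1)...(2p - 1) = (2p - 1)! / p!. *)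
Lemma rising_horner_bin (R : comNzRingType) (p : nat) : (0 < p)%N ->
  (rising p : {poly R}).[p%:R] = ('C(2 * p - 1, p - 1) * (p.-1)`!)%:R.
Proof.
move=> p_gt0; pose g m := (\prod_(1 <= j < m) (p + j))%N.
have gE m : (0 < m -> p`! * g m = (p + m).-1`!)%N.
  elim: m => // -[_ _|m IHm _]; first by rewrite /g big_geq // muln1 addn1.
  by rewrite /g big_nat_recr //= mulnA IHm // !addnS /= mulnC factS.
have -> : ('C(2 * p - 1, p - 1) * p.-1`! = g p)%N.
  have /bin_fact := (ltac:(lia) : (p - 1 <= 2 * p - 1)%N); have := gE p p_gt0.
  have -> : (2 * p - 1 - (p - 1) = p)%N by lia.
  have -> : ((p + p).-1 = 2 * p - 1)%N by lia.
  rewrite -subn1 => <- h; apply/eqP.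
  by rewrite -(eqn_pmul2l (fact_gt0 p)) -h mulnCA [(p`! * _)%N]mulnC.
rewrite /rising horner_prod natr_prod; apply: eq_bigr => j _.
by rewrite !hornerE natrD.
Qed.

(** In f(-p) = a_0, the facts p^2 | a_3 and p | a_4 make the terms in p^3 and p^4 multiples of p^5;
    one factor p is then cancelled. *)
Lemma rising_coef1E (p : nat) : prime p -> (7 <= p)%N ->
  exists c : int, (rising p : {poly int})`_1 = p%:Z * (rising p)`_2 + c * p%:Z ^+ 4.
Proof.
move=> p_pr p_ge7; have p_odd := prime_ge7_odd p p_pr p_ge7.
set f : {poly int} := rising p.
have := congr1 (horner^~ 0) (rising_comp int p p_odd).
rewrite horner_comp !hornerE horner_coef0 natz -/f.
rewrite (horner_drop _ 5) !big_ord_recr big_ord0 /=.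
have /dvdzP[c ->] : (p %| f`_4)%Z by apply: rising_coef_dvd => //; lia.
have /dvdzP[d ->] := rising_coef3_dvd p p_pr p_ge7.
set r := _.[_] => e.
exists (- d + c - r).
have p_neq0 : p%:Z != 0 by lia.
apply: (mulfI p_neq0).
by apply: subr0_eq; rewrite -[RHS](subrr f`_0) -[X in _ = _ - X]e; ring.
Qed.

(** In f(p) - f(-p), where f(-p) = a_0, the even terms below p^5 cancel and 2 a_3 p^3 is a multiple
    of p^5, so only 2 p a_1 survives. *)
Lemma bin_rising_coef1 (p : nat) : prime p -> (7 <= p)%N ->
  exists c : int, ('C(2 * p - 1, p - 1)%:Z - 1) * (p.-1)`!%:Z =
    2 * p%:Z * (rising p : {poly int})`_1 + c * p%:Z ^+ 5.
Proof.
move=> p_pr p_ge7; have p_odd := prime_ge7_odd p p_pr p_ge7.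
have := rising_horner_bin int p ltac:(lia); have := rising_coef0 int p.
have := congr1 (horner^~ 0) (rising_comp int p p_odd).
set f : {poly int} := rising p.
rewrite horner_comp !hornerE horner_coef0 !natz PoszM => e <-.
rewrite mulrBl mul1r => <-; rewrite -{1}e.
rewrite !(horner_drop _ 5 f) !big_ord_recr !big_ord0 /=.
have /dvdzP[d ->] := rising_coef3_dvd p p_pr p_ge7.
set r := _.[_]; set r' := _.[_].
by exists (2 * d + r + r'); ring.
Qed.

(** * Conditions (a), (b), (c) as divisibility of a_1 and a_2 *)

Lemma natr_Zp_unit (p e k : nat) : prime p -> (0 < e)%N -> (0 < k < p)%N ->
  (k%:R : 'Z_(p ^ e)) \is a GRing.unit.
Proof.
move=> p_pr e_gt0 /andP[k_gt0 lt_kp]; have p_gt1 := prime_gt1 p_pr.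
rewrite unitZpE ?(ltn_exp2l 0) // coprime_pexpl // prime_coprime //.
by apply/negP => /(dvdn_leq k_gt0); rewrite leqNgt lt_kp.
Qed.

Lemma PoszX (m n : nat) : (m ^ n)%N%:Z = m%:Z ^+ n.
Proof. by rewrite -natz natrX natz. Qed.

Lemma coprime_fact_pred (p : nat) : prime p -> coprime p (p.-1)`!.
Proof.
move=> p_pr; have := p_pr; rewrite Wilson ?prime_gt1 // => /coprime_dvdl -> //.
by rewrite coprime_sym coprimenS.
Qed.

Lemma binomial_congruence_coef1 (p : nat) : prime p -> (7 <= p)%N ->
  'C(2 * p - 1, p - 1) = 1 %[mod p ^ 5] <->
  (p%:Z ^+ 4 %| (rising p : {poly int})`_1)%Z.
Proof.
move=> p_pr p_ge7; have [c e] := bin_rising_coef1 p p_pr p_ge7.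
have cop : coprimez (p%:Z ^+ 5) (p.-1)`! 
  by apply: coprimezXl; rewrite coprimezE /= coprime_fact_pred.
have cop2 : coprimez (p%:Z ^+ 4) 2.
  apply: coprimezXl; rewrite coprimezE prime_coprime //=.
  by apply/negP => /(@dvdn_leq _ 2 isT); lia.
have -> : ('C(2 * p - 1, p - 1) = 1 %[mod p ^ 5]) <->
    (p%:Z ^+ 5 %| 'C(2 * p - 1, p - 1)%:Z - 1)%Z.
  rewrite -PoszX -eqz_mod_dvd !modz_nat eqz_nat; exact: rwP eqP.
rewrite -(Gauss_dvdzl _ cop) e (rpredDr _ (dvdz_mull c (dvdzz _))) mulrAC exprSr.
by rewrite dvdz_mul2r ?Gauss_dvdzr //; lia.
Qed.

Lemma rising_coef12_dvd (p : nat) : prime p -> (7 <= p)%N ->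
  (p%:Z ^+ 4 %| (rising p : {poly int})`_1)%Z =
  (p%:Z ^+ 3 %| (rising p : {poly int})`_2)%Z.
Proof.
move=> p_pr p_ge7; have [c ->] := rising_coef1E p p_pr p_ge7.
by rewrite (rpredDr _ (dvdz_mull c (dvdzz _))) exprS dvdz_mul2l //; lia.
Qed.

Lemma coef_rising_Zp (p e : nat) : prime p -> (0 < e)%N ->
  let a i : 'Z_(p ^ e) := ((rising p : {poly int})`_i)%:~R in
  [/\ a 0 \is a GRing.unit,
      a 1 = a 0 * \sum_(1 <= k < p) k%:R^-1 &
      a 1 ^+ 2 - 2%:R * a 0 * a 2 = a 0 ^+ 2 * \sum_(1 <= k < p) (k ^ 2)%:R^-1].
Proof.
move=> p_pr e_gt0 a.
have aE i : a i = (rising p : {poly 'Z_(p ^ e)})`_i.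
  by rewrite -(map_rising int 'Z_(p ^ e) intr) coef_map.
(* The range is repeated in the predicate so that invertibility is only required of 1, ..., p - 1;
   [big_nat_cond] removes it afterwards. *)
have [] := coef_prod_inv 'Z_(p ^ e) nat (index_iota 1 p)
  (fun i => (1 <= i < p)%N && true) (fun j => j%:R).
  by move=> i; rewrite andbT; apply: natr_Zp_unit.
rewrite -!big_nat_cond -/(rising p) -!aE => e0 e1 e2; split=> //.
  rewrite aE rising_coef0 unitZpE ?(ltn_exp2l 0) ?prime_gt1 //.
  by rewrite coprime_pexpl // coprime_fact_pred.
by under eq_bigr do rewrite natrX.
Qed.

Lemma harmonic_Zp_eq0 (p : nat) : prime p ->
  \sum_(1 <= k < p) k%:R^-1 = 0 :> 'Z_(p ^ 4) <->
  (p%:Z ^+ 4 %| (rising p : {poly int})`_1)%Z.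
Proof.
move=> p_pr; have [a0U e1 _] := coef_rising_Zp p 4 p_pr isT.
rewrite -PoszX -intr_Zp_eq0 ?(ltn_exp2l 0) ?prime_gt1 // e1.
by rewrite mulrI_eq0; [exact: rwP eqP | exact: mulrI].
Qed.

(** As p | a_2, a_1 = p a_2 + c p^4 is a multiple of p^2, so a_1^2 vanishes mod p^3. What remains
    equates -2 a_0 a_2 with a_0^2 times the sum, where 2 and a_0 are units. *)
Lemma harmonic2_Zp_eq0 (p : nat) : prime p -> (7 <= p)%N ->
  \sum_(1 <= k < p) (k ^ 2)%:R^-1 = 0 :> 'Z_(p ^ 3) <->
  (p%:Z ^+ 3 %| (rising p : {poly int})`_2)%Z.
Proof.
move=> p_pr p_ge7; have [a0U _] := coef_rising_Zp p 3 p_pr isT.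
have pe_gt1 : (1 < p ^ 3)%N by rewrite (ltn_exp2l 0) ?prime_gt1.
have twoU := natr_Zp_unit p 3 2 p_pr isT ltac:(lia).
have -> : (((rising p : {poly int})`_1)%:~R ^+ 2 : 'Z_(p ^ 3)) = 0.
  apply/eqP; rewrite -rmorphXn /= intr_Zp_eq0 // PoszX.
  have [c ->] := rising_coef1E p p_pr p_ge7.
  have /dvdzP[d ->] : (p %| (rising p : {poly int})`_2)%Z.
    by apply: rising_coef_dvd => //; lia.
  by apply/dvdzP; exists (p%:Z * (d + c * p%:Z ^+ 2) ^+ 2); ring.
rewrite sub0r => e2; rewrite -PoszX -intr_Zp_eq0 //.
have a02U : 2 * ((rising p : {poly int})`_0)%:~R \is a @GRing.unit 'Z_(p ^ 3).
  by rewrite unitrM twoU.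
rewrite -(mulrI_eq0 _ (mulrI a02U)).
rewrite -oppr_eq0 e2 mulrI_eq0; last by apply: mulrI; rewrite unitrX.
exact: rwP eqP.
Qed.

(** * Power sums expressed by Bernoulli numbers *)

Lemma bernoulli_convE (m : nat) :
  \sum_(i < m.+1) bernoulli i / i`!%:R / (m.+1 - i)`!%:R = (m == 0%N)%:R.
Proof.
by rewrite big_ord_recr /= subSnn divr1 -bernoulli_gfS bernoulliP /fps_t eqSS.
Qed.

Lemma exprDn_fact (x y : rat) (n : nat) :
  (x + y) ^+ n / n`!%:R = \sum_(l < n.+1) y ^+ l / l`!%:R * (x ^+ (n - l) / (n - l)`!%:R).
Proof.
rewrite exprDn mulr_suml; apply: eq_bigr => l _; rewrite -mulr_natr.
have := fact_ratr_neq0 l; have := fact_ratr_neq0 (n - l); have := fact_ratr_neq0 n.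
rewrite -(bin_fact (ltn_ord l : l <= n)%N) !natrM => h1 h2 h3; field.
move: h1; rewrite !mulf_eq0 !negb_or => /andP[-> _].
by rewrite h2 h3.
Qed.

(** Faulhaber's formula divided by k!, which makes the step from n to n + 1 a convolution: after
    expanding (1 + n)^(k + 1 - s) and exchanging sums, the coefficient of n^l is a Bernoulli
    convolution that vanishes unless l = k. *)
Lemma sum_pow_fact (k n : nat) :
  (\sum_(j < n) j%:R ^+ k) / k`!%:R =
  \sum_(s < k.+1) bernoulli s / s`!%:R * (n%:R ^+ (k.+1 - s) / (k.+1 - s)`!%:R) :> rat.
Proof.
elim: n => [|n IHn].
  rewrite big_ord0 mul0r big1 // => s _.
  by rewrite expr0n subn_eq0 leqNgt ltn_ord mul0r mulr0.
rewrite big_ord_recr /= mulrDl IHn -natr1 (addrC n%:R 1).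
under [RHS]eq_bigr => s _ do
  rewrite exprDn_fact big_ord_recr /= subnn expr0 fact0 invr1 !mulr1 mulrDr.
rewrite big_split /= [RHS]addrC; congr (_ + _).
(* The bound on l that depends on s becomes a condition over a fixed range, which permits the
   exchange. *)
transitivity (\sum_(s < k.+1) \sum_(l < k.+1 | (l < k.+1 - s)%N)
   n%:R ^+ l / l`!%:R * (bernoulli s / s`!%:R / (k.+1 - l - s)`!%:R) : rat); last first.
  apply: eq_bigr => s _; rewrite mulr_sumr.
  rewrite -(big_ord_widen_cond _ xpredT (fun l => n%:R ^+ l / l`!%:R *
    (bernoulli s / s`!%:R / (k.+1 - l - s)`!%:R) : rat)) ?leq_subr //.
  by apply: eq_bigr => l _; rewrite expr1n mul1r subnAC mulrCA.
rewrite (exchange_big_dep xpredT) //=.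
rewrite (eq_bigr (fun l : 'I_k.+1 => n%:R ^+ l / l`!%:R * (k - l == 0)%N%:R)); last first.
  move=> l _; rewrite -mulr_sumr -bernoulli_convE -subSn -1?ltnS //; congr (_ * _).
  rewrite (big_ord_widen_cond k.+1 xpredT
    (fun s => bernoulli s / s`!%:R / (k.+1 - l - s)`!%:R)) ?leq_subr //.
  by apply: eq_bigl => s; lia.
rewrite (bigD1 ord_max) //= subnn mulr1 [X in _ + X]big1 ?addr0 // => l.
rewrite -val_eqE /= => l_neqk; rewrite (_ : k - l == 0 = false)%N ?mulr0 //.
by apply/negbTE; have := ltn_ord l; lia.
Qed.

(** Here i = k - s, and n^(i + 1) is split so that for n = p the factors p B_(k - i) and p^i / (i +
    1) can be bounded separately. *)
Lemma sum_powE (k n : nat) :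
  (\sum_(j < n) j ^ k)%N%:R =
  \sum_(i < k.+1) 'C(k, i)%:R * (n%:R * bernoulli (k - i)) * (n%:R ^+ i / i.+1%:R) :> rat.
Proof.
have kN0 := fact_ratr_neq0 k; apply: (divIf kN0).
rewrite natr_sum (eq_bigr (fun j : 'I_n => j%:R ^+ k)) => [|j _]; last by rewrite natrX.
rewrite sum_pow_fact mulr_suml (reindex_inj rev_ord_inj) /=; apply: eq_bigr => i _.
have le_ik : (i <= k)%N by rewrite -ltnS.
rewrite subSS (_ : k.+1 - (k - i) = i.+1)%N; last by lia.
have := fact_ratr_neq0 i; have := fact_ratr_neq0 (k - i); move: kN0.
rewrite -(bin_fact le_ik) factS !natrM exprS => h1 h2 h3; field.
have iN0 : i.+1%:R != 0 :> rat by rewrite pnatr_eq0.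
move: h1; rewrite !mulf_eq0 !negb_or => /andP[-> _].
by rewrite h2 h3 nat1r iN0.
Qed.

(** * Divisibility by p^e among p-integral rationals *)

(* [x] lies in p^e Z_(p). *)
Definition padic_dvd (p e : nat) (x : rat) : Prop :=
  exists (a : int) (b : nat), coprime p b /\ x * b%:R = a%:~R * p%:R ^+ e.

Lemma coprime_natr_neq0 (p : nat) (p_pr : prime p) (b : nat) : coprime p b -> b%:R != 0 :> rat.
Proof.
rewrite pnatr_eq0; case: b => //; rewrite /coprime gcdn0 => /eqP p1.
by have := p_pr; rewrite p1.
Qed.

Lemma padic_dvd_int (p e : nat) (a : int) : (p%:Z ^+ e %| a)%Z -> padic_dvd p e a%:~R.
Proof.
case/dvdzP => c ->; exists c, 1%N; rewrite coprimen1 mulr1 rmorphM rmorphXn /=.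
by split.
Qed.

Lemma padic_dvd_nat (p n : nat) : padic_dvd p 0 n%:R.
Proof. by rewrite pmulrn; apply: padic_dvd_int; rewrite expr0 dvd1z. Qed.

Lemma padic_dvdX (p e : nat) : padic_dvd p e (p%:R ^+ e).
Proof. by exists 1, 1%N; rewrite coprimen1 mulr1 mul1r. Qed.

Lemma padic_dvdD (p e : nat) (x y : rat) :
  padic_dvd p e x -> padic_dvd p e y -> padic_dvd p e (x + y).
Proof.
move=> [a [b [cb xE]]] [c [d [cd yE]]].
exists (a * d%:Z + c * b%:Z), (b * d)%N; rewrite coprimeMr cb cd; split=> //.
rewrite natrM rmorphD !rmorphM /= -!pmulrn mulrDl mulrA xE mulrCA yE; ring.
Qed.

Lemma padic_dvdN (p e : nat) (x : rat) : padic_dvd p e x -> padic_dvd p e (- x).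
Proof.
by move=> [a [b [cb xE]]]; exists (- a), b; rewrite mulNr xE rmorphN mulNr.
Qed.

Lemma padic_dvdB (p e : nat) (x y : rat) :
  padic_dvd p e x -> padic_dvd p e y -> padic_dvd p e (x - y).
Proof. by move=> xP yP; apply/padic_dvdD/padic_dvdN. Qed.

Lemma padic_dvdM (p e f : nat) (x y : rat) :
  padic_dvd p e x -> padic_dvd p f y -> padic_dvd p (e + f) (x * y).
Proof.
move=> [a [b [cb xE]]] [c [d [cd yE]]].
exists (a * c), (b * d)%N; rewrite coprimeMr cb cd; split=> //.
by rewrite natrM rmorphM mulrACA xE yE exprD mulrACA.
Qed.

Lemma padic_dvdW (p e f : nat) (x : rat) :
  (f <= e)%N -> padic_dvd p e x -> padic_dvd p f x.
Proof.
move=> /subnK<- [a [b [cb xE]]]; exists (a * p%:Z ^+ (e - f)), b; split=> //.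
by rewrite xE rmorphM rmorphXn /= exprD mulrA.
Qed.

Lemma padic_dvd_sum (p : nat) (I : Type) (s : seq I) (P : pred I)
  (F : I -> rat) (e : nat) :
  (forall i, P i -> padic_dvd p e (F i)) -> padic_dvd p e (\sum_(i <- s | P i) F i).
Proof.
move=> FP; elim/big_ind: _ => //; last exact: padic_dvdD.
by exists 0, 1%N; rewrite coprimen1 !mul0r.
Qed.

Lemma padic_dvdV (p : nat) (p_pr : prime p) (b : nat) : coprime p b -> padic_dvd p 0 b%:R^-1.
Proof.
by move=> cb; exists 1, b; rewrite mulVf ?(coprime_natr_neq0 p) // expr0 mulr1.
Qed.

Lemma padic_dvdMl (p : nat) (p_pr : prime p) (e f : nat) (x : rat) :
  padic_dvd p (e + f) (p%:R ^+ e * x) -> padic_dvd p f x.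
Proof.
move=> [a [b [cb xE]]]; exists a, b; split=> //.
have pe_neq0 : p%:R ^+ e != 0 :> rat.
  by rewrite expf_neq0 // pnatr_eq0 -lt0n prime_gt0.
by apply: (mulfI pe_neq0); rewrite mulrA xE exprD mulrCA.
Qed.

(** For e = 0 the right-hand side would always hold, the left-hand side only for p-integral x; for e
    > 0 a numerator divisible by p forces a denominator prime to p. *)
Lemma padic_dvd_numq (p : nat) (p_pr : prime p) (e : nat) (x : rat) : (0 < e)%N ->
  padic_dvd p e x <-> (p%:Z ^+ e %| numq x)%Z.
Proof.
move=> e_gt0; split=> [[a [b [cb xE]]] | pe_num].
  have cop : coprimez (p%:Z ^+ e) b by apply: coprimezXl; rewrite coprimezE.
  rewrite -(Gauss_dvdzl _ cop).
  suff -> : numq x * b%:Z = a * denq x * p%:Z ^+ e by apply: dvdz_mull.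
  apply/eqP; rewrite -(eqr_int rat) !rmorphM rmorphXn /= -!pmulrn.
  by rewrite [a%:~R * _]mulrC -mulrA -xE mulrA [_ * x]mulrC -numqE.
exists (numq x %/ p%:Z ^+ e)%Z, `|denq x|%N; split.
  apply: (@coprime_dvdl _ `|numq x|); last exact: coprime_num_den.
  move: pe_num; rewrite dvdzE; apply: dvdn_trans.
  by rewrite -PoszX /= dvdn_exp.
rewrite pmulrn absz_denq -numqE.
have -> : p%:R ^+ e = (p%:Z ^+ e)%:~R :> rat by rewrite rmorphXn.
by rewrite -intrM divzK.
Qed.

(** * Integrality of p B_k and truncation of the power sum formula *)

(** Let v be the p-adic valuation of i + 1. From 5^v <= i + 1 and 4 v < 5^v follows i - v >= 3 v, so
    the exponent i - v is at least 3 if v > 0, and equals i if v = 0. *)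
Lemma padic_dvd_powdiv (p e i : nat) : prime p -> (5 <= p)%N ->
  (e <= 3)%N -> (e <= i)%N -> padic_dvd p e (p%:R ^+ i / i.+1%:R).
Proof.
move=> p_pr p_ge5 e_le3 le_ei.
have [m cpm iE] := pfactor_coprime p_pr (ltn0Sn i); set v := logn p i.+1 in iE.
have v_le : (4 * v <= i)%N.
  have m_gt0 : (0 < m)%N by case: m iE {cpm}.
  have : (5 ^ v <= i.+1)%N.
    rewrite iE; apply: leq_trans (leq_pmull _ m_gt0).
    by case: (v) => // w; rewrite leq_exp2r.
  have : (4 * v < 5 ^ v)%N by elim: (v) => // w IHw; rewrite expnS; lia.
  lia.
have -> : p%:R ^+ i / i.+1%:R = p%:R ^+ (i - v) * m%:R^-1 :> rat.
  rewrite iE natrM natrX invfM mulrA mulrAC.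
  rewrite -{1}(subnK (_ : v <= i)%N); last by lia.
  by rewrite exprD mulfK // expf_neq0 // pnatr_eq0 -lt0n prime_gt0.
rewrite -[e]addn0; apply: padic_dvdM => //; last exact: padic_dvdV.
by apply: padic_dvdW (padic_dvdX _ _); lia.
Qed.

(** A weak form of von Staudt-Clausen: in the formula for the k-th power sum below p, the term i = 0
    is p B_k, and the others are p-integral by strong induction. *)
Lemma padic_dvd_pbern (p k : nat) : prime p -> (5 <= p)%N ->
  padic_dvd p 0 (p%:R * bernoulli k).
Proof.
move=> p_pr p_ge5; elim/ltn_ind: k => k IHk.
have := sum_powE k p; rewrite big_ord_recl /= bin0 subn0 divr1 mul1r.
move/(canLR (addrK _)) => <-; apply: padic_dvdB => //; first exact: padic_dvd_nat.
apply: padic_dvd_sum => // i _; rewrite -[bump 0 i]/i.+1.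
apply: (padic_dvdM p 0 0); last exact: padic_dvd_powdiv.
apply: (padic_dvdM p 0 0); first exact: padic_dvd_nat.
by apply: IHk; have := ltn_ord i; lia.
Qed.

Lemma sum_pow_trunc (p k e : nat) : prime p -> (5 <= p)%N -> (e <= 3)%N -> (e <= k.+1)%N ->
  padic_dvd p e ((\sum_(j < p) j ^ k)%N%:R -
    \sum_(i < e) 'C(k, i)%:R * (p%:R * bernoulli (k - i)) * (p%:R ^+ i / i.+1%:R)).
Proof.
move=> p_pr p_ge5 e_le3 le_ek; rewrite sum_powE -(subnKC le_ek) big_split_ord /=.
rewrite addrAC subrr add0r; apply: padic_dvd_sum => // i _.
apply: (padic_dvdM p 0 e); last by apply: padic_dvd_powdiv; lia.
apply: (padic_dvdM p 0 0); first exact: padic_dvd_nat.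
exact: padic_dvd_pbern.
Qed.

(** * Power sums modulo p and p^2 *)

(** With q the order of F, d represents -k modulo q - 1. Some nonzero g has g^d != 1, as X^d - 1 has
    at most d < q - 1 roots; since g^(k + d) = 1, also g^k != 1, and the substitution x -> g x gives
    S = g^k S. *)
Lemma sum_expr_finField (F : finFieldType) (k d : nat) :
  (0 < d < #|F|.-1)%N -> (#|F|.-1 %| k + d)%N -> \sum_(x : F) x ^+ k = 0.
Proof.
move=> /andP[d_gt0 d_lt] dvd_kd.
have [g g_neq0 gd_neq1] : exists2 g : F, g != 0 & g ^+ d != 1.
  apply/exists_inP; rewrite -[X in is_true X]negbK negb_exists_in.
  apply/negP => /forall_inP all1.
  have Xd_neq0 : 'X^d - 1 != 0 :> {poly F} by rewrite -size_poly_eq0 size_XnsubC.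
  have := max_poly_roots Xd_neq0 (rs := enum [pred x : F | x != 0]).
  rewrite enum_uniq size_XnsubC // -cardE.
  have -> : #|[pred x : F | x != 0]| = #|F|.-1.
    by rewrite -(cardC1 (0 : F)); apply: eq_card => x; rewrite !inE.
  rewrite ltnS leqNgt d_lt => impl; have : false; last by [].
  apply: impl => //; apply/allP => x; rewrite mem_enum inE => x_neq0.
  by rewrite rootE !hornerE subr_eq0; have := all1 x x_neq0; rewrite negbK.
have g1 : g ^+ #|F|.-1 = 1.
  apply: (mulfI g_neq0); rewrite -exprS prednK ?expf_card ?mulr1 //.
  by apply/card_gt0P; exists 0.
set S := \sum_x _; have SE : S = g ^+ k * S.
  rewrite {1}/S (reindex_inj (mulfI g_neq0)) mulr_sumr.
  by apply: eq_bigr => x _; rewrite exprMn.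
apply/eqP; apply: contraR gd_neq1 => S_neq0.
have gk1 : g ^+ k = 1 by apply: (mulIf S_neq0); rewrite -SE mul1r.
have : g ^+ (k + d) = 1 by rewrite -(divnK dvd_kd) mulnC exprM g1 expr1n.
by rewrite exprD gk1 mul1r => ->.
Qed.

Lemma dvdn_sum_pow (p k d : nat) : prime p ->
  (0 < d < p.-1)%N -> (p.-1 %| k + d)%N -> (p %| \sum_(j < p) j ^ k)%N.
Proof.
move=> p_pr d_lt dvd_kd.
rewrite (dvdn_pcharf (pchar_Fp p_pr)); apply/eqP.
pose F (j : nat) : 'F_p := j%:R ^+ k.
transitivity (\sum_(j < p) F j).
  by rewrite natr_sum; apply: eq_bigr => j _; rewrite natrX.
(* The carrier of ['F_p] is an ordinal type whose bound equals p only propositionally; [FE] changes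
   the bound and keeps the terms. *)
have FE n : n = p -> \sum_(j < p) F j = \sum_(j < n) F j by move=> ->.
rewrite (FE _ (Fp_cast p_pr)) -[RHS](sum_expr_finField 'F_p k d) ?card_Fp //.
by apply: eq_bigr => x _; rewrite /F natr_Zp.
Qed.

Lemma exprD_trunc2 (R : comNzRingType) (x y : R) (n : nat) :
  exists c : R, (x + y) ^+ n.+1 = x ^+ n.+1 + n.+1%:R * x ^+ n * y + c * y ^+ 2.
Proof.
elim: n => [|n [c IHn]]; first by exists 0; rewrite !expr1 expr0; ring.
exists (c * (x + y) + n.+1%:R * x ^+ n).
by rewrite exprS IHn -(natr1 n.+1) !exprS; ring.
Qed.

(* Pairs [j] with [p - j]. *)
Lemma dvdz_sum_pow_odd (p k d : nat) : prime p -> odd p -> ~~ odd k ->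
  (0 < k)%N -> (0 < d < p.-1)%N -> (p.-1 %| k + d)%N ->
  (p%:Z ^+ 2 %| (\sum_(j < p) j ^ k.+1)%N%:Z)%Z.
Proof.
move=> p_pr p_odd k_even k_gt0 d_lt dvd_kd; have p_gt0 := prime_gt0 p_pr.
have cop : coprimez (p%:Z ^+ 2) 2.
  by apply: coprimezXl; rewrite coprimezE coprimen2.
rewrite -(Gauss_dvdzr _ cop).
have pE k' : (0 < k')%N -> ((\sum_(j < p) j ^ k')%N%:Z = \sum_(1 <= j < p) j%:Z ^+ k').
  move=> k'_gt0; rewrite -(big_mkord xpredT (fun j => j ^ k')%N) big_ltn // exp0n //.
  by rewrite add0n -natz natr_sum; apply: eq_bigr => j _; rewrite natrX natz.
(* For even k, (p - j)^(k + 1) = -j^(k + 1) + (k + 1) p j^k (mod p^2), so twice the sum is (k + 1) p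
   times the k-th power sum, itself a multiple of p. *)
have dvd_Sk : (p%:Z ^+ 2 %| k.+1%:R * p%:Z * (\sum_(j < p) j ^ k)%N%:Z)%Z.
  have /dvdzP[b ->] : (p %| (\sum_(j < p) j ^ k)%N%:Z)%Z by exact: (dvdn_sum_pow p k d).
  by apply/dvdzP; exists (k.+1%:R * b); ring.
rewrite -(rpredBr _ dvd_Sk) mulr_natl mulr2n !pE // {1}big_nat_rev /= -big_split /=.
rewrite mulr_sumr -sumrB big_nat_cond; apply: rpred_sum => j.
rewrite andbT => /andP[j_gt0 lt_jp].
rewrite add1n subSS -subzn ?(ltnW lt_jp) // (addrC p%:Z).
have [c ->] := exprD_trunc2 int (- j%:Z) p%:Z k.
rewrite !exprS exprNn -(signr_odd _ k) (negbTE k_even) expr0 mul1r.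
by apply/dvdzP; exists c; ring.
Qed.

(** * Condition (d) and the power sum with exponent m = p^3 - p^2 - 2 *)

(** Since m + 2 is the totient of p^3, the m-th power inverts squares of units mod p^3; the lower
    bound keeps m - 2 from truncating. *)
Lemma bernoulli_indexE (p : nat) : prime p -> (7 <= p)%N ->
  (p ^ 3 - p ^ 2 - 2 + 2 = p ^ 2 * p.-1)%N /\ (6 <= p ^ 3 - p ^ 2 - 2)%N.
Proof.
by move=> p_pr p_ge7; split; case: p p_ge7 {p_pr} => // p; rewrite !expnS expn0 /=; nia.
Qed.

Lemma harmonic2_Zp_sum_pow (p : nat) : prime p -> (7 <= p)%N ->
  \sum_(1 <= k < p) (k ^ 2)%:R^-1 =
  (\sum_(j < p) j ^ (p ^ 3 - p ^ 2 - 2))%N%:R :> 'Z_(p ^ 3).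
Proof.
move=> p_pr p_ge7; have [] := bernoulli_indexE p p_pr p_ge7.
set m := (p ^ 3 - p ^ 2 - 2)%N => mE m_ge6.
have p_gt0 := prime_gt0 p_pr; have pe_gt1 : (1 < p ^ 3)%N by rewrite (ltn_exp2l 0) ?prime_gt1.
rewrite -(big_mkord xpredT (fun j => j ^ m)%N) big_ltn // exp0n ?add0n; last by lia.
rewrite natr_sum; apply: eq_big_nat => k lt_kp.
have kU := natr_Zp_unit p 3 k p_pr isT lt_kp.
have k2U : (k ^ 2)%:R \is a @GRing.unit 'Z_(p ^ 3) by rewrite natrX unitrX.
apply: (mulrI k2U); rewrite divrr // -natrM -expnD addnC mE.
have cpk : coprime k (p ^ 3) by rewrite coprime_sym -unitZpE.
have := Euler_exp_totient cpk; rewrite totient_pfactor // mulnC => kE.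
by rewrite -(Zp_nat_mod pe_gt1) kE Zp_nat_mod.
Qed.

Lemma sum_pow_bernoulli (p : nat) : prime p -> (7 <= p)%N ->
  (p%:Z ^+ 3 %| (\sum_(j < p) j ^ (p ^ 3 - p ^ 2 - 2))%N%:Z)%Z <->
  (p%:Z ^+ 2 %| numq (bernoulli (p ^ 3 - p ^ 2 - 2)))%Z.
Proof.
move=> p_pr p_ge7; have [] := bernoulli_indexE p p_pr p_ge7.
set m := (p ^ 3 - p ^ 2 - 2)%N => mE m_ge6.
have p_ge5 : (5 <= p)%N by lia.
have p_odd := prime_ge7_odd p p_pr p_ge7.
have m_even : ~~ odd m.
  have /(congr1 odd) := mE; rewrite oddD addbF oddM oddX /= p_odd => ->.
  by case: p p_odd {p_pr p_ge7 m mE m_ge6 p_ge5} => //=.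
(* As (m - 2) + 4 = p^2 (p - 1) and 4 < p - 1, p divides the sum of the j^(m - 2), which is p B_(m -
   2) mod p. *)
have B2 : padic_dvd p 0 (bernoulli (m - 2)).
  apply: (padic_dvdMl p p_pr 1); rewrite expr1.
  have := sum_pow_trunc p (m - 2) 1 p_pr p_ge5 isT isT.
  rewrite big_ord1 bin0 subn0 divr1 mul1r => tP.
  rewrite -[_ * _](subKr (\sum_(j < p) j ^ (m - 2))%N%:R); apply: padic_dvdB => //.
  rewrite pmulrn; apply: padic_dvd_int; rewrite expr1.
  apply: (dvdn_sum_pow p (m - 2) 4) => //; first by lia.
  by rewrite (_ : m - 2 + 4 = p ^ 2 * p.-1)%N ?dvdn_mull //; lia.
have half_int : padic_dvd p 0 2^-1.
  by apply: padic_dvdV => //; rewrite coprime_sym coprime2n.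
(* Mod p^2 the sum of the j^(m - 1) is p B_(m - 1) + (m - 1) p^2 B_(m - 2) / 2; it vanishes by the
   pairing, m - 1 being odd. *)
have B1 : padic_dvd p 1 (bernoulli (m - 1)).
  apply: (padic_dvdMl p p_pr 1); rewrite expr1.
  have := sum_pow_trunc p (m - 1) 2 p_pr p_ge5 isT ltac:(lia).
  rewrite big_ord_recl big_ord1 bin0 subn0 divr1 mul1r /= -[bump 0 0]/1%N bin1.
  rewrite (_ : m - 1 - 1 = m - 2)%N; last by lia.
  set T := _%:R * _ * _ => tP.
  set S : rat := (\sum_(j < p) j ^ (m - 1))%N%:R in tP.
  rewrite (_ : p%:R * _ = S - (S - (p%:R * bernoulli (m - 1) + T)) - T); last by ring.
  apply: padic_dvdB; first apply: padic_dvdB => //.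
    rewrite /S pmulrn; apply: padic_dvd_int.
    rewrite (_ : m - 1 = (m - 2).+1)%N; last by lia.
    apply: (dvdz_sum_pow_odd p (m - 2) 4) => //; try lia.
    by rewrite (_ : m - 2 + 4 = p ^ 2 * p.-1)%N ?dvdn_mull //; lia.
  rewrite /T expr1 (_ : _ * _ =
    (m - 1)%:R * (p%:R ^+ 2 * (bernoulli (m - 2) * 2^-1))); last by ring.
  apply: (padic_dvdM p 0 2); first exact: padic_dvd_nat.
  by apply: (padic_dvdM p 2 0); [exact: padic_dvdX | exact: (padic_dvdM p 0 0)].
rewrite -padic_dvd_numq //.
have := sum_pow_trunc p m 3 p_pr p_ge5 isT ltac:(lia).
rewrite 2!big_ord_recl big_ord1 bin0 subn0 divr1 mul1r /= -[bump 0 0]/1%N -[bump 0 1]/2%N bin1.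
(* These are m p^2 B_(m - 1) / 2 and C(m, 2) p^3 B_(m - 2) / 3; in the first, B_(m - 1) supplies the
   third factor p. *)
set T1 := _%:R * _ * _; set T2 := _%:R * _ * _.
set S : rat := (\sum_(j < p) j ^ m)%N%:R => tP.
have T1P : padic_dvd p 3 T1.
  rewrite /T1 expr1 (_ : _ * _ =
    m%:R * (p%:R ^+ 2 * (bernoulli (m - 1) * 2^-1))); last by ring.
  apply: (padic_dvdM p 0 3); first exact: padic_dvd_nat.
  by apply: (padic_dvdM p 2 1); [exact: padic_dvdX | exact: (padic_dvdM p 1 0)].
have T2P : padic_dvd p 3 T2.
  rewrite /T2 (_ : _ * _ =
    'C(m, 2)%:R * (p%:R ^+ 3 * (bernoulli (m - 2) * 3^-1))); last by ring.
  apply: (padic_dvdM p 0 3); first exact: padic_dvd_nat.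
  apply: (padic_dvdM p 3 0); first exact: padic_dvdX.
  apply: (padic_dvdM p 0 0) => //; apply: padic_dvdV => //.
  by rewrite prime_coprime //; apply/negP => /(@dvdn_leq _ 3 isT); lia.
have -> : (p%:Z ^+ 3 %| (\sum_(j < p) j ^ m)%N%:Z)%Z <-> padic_dvd p 3 S.
  by rewrite /S pmulrn padic_dvd_numq // numq_int.
split=> [SP | BP].
  apply: (padic_dvdMl p p_pr 1); rewrite expr1.
  rewrite (_ : _ * _ = S - (S - (p%:R * bernoulli m + (T1 + T2))) - T1 - T2); last by ring.
  by do 3?apply: padic_dvdB.
rewrite (_ : S = S - (p%:R * bernoulli m + (T1 + T2)) + p%:R * bernoulli m + T1 + T2);
  last by ring.
do 3?apply: padic_dvdD => //.
by apply: (padic_dvdM p 1 2) => //; rewrite -[X in padic_dvd p 1 X]expr1; exact: padic_dvdX.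
Qed.

(** * The cycle of implications from (a) through (b), (c), (d) back to (a) *)

Theorem theorem2 (p : nat) (p_ge7 : (7 <= p)%N) (p_prime : prime p) :
  [<-> 'C(2 * p - 1, p - 1) = 1 %[mod p ^ 5];
       \sum_(1 <= k < p) k%:R^-1 = 0 :> 'Z_(p ^ 4);
       \sum_(1 <= k < p) (k ^ 2)%:R^-1 = 0 :> 'Z_(p ^ 3);
       ((p ^ 2)%N %| numq (bernoulli (p ^ 3 - p ^ 2 - 2)))%Z].
Proof.
have ab := binomial_congruence_coef1 p p_prime p_ge7.
have b := harmonic_Zp_eq0 p p_prime.
have c := harmonic2_Zp_eq0 p p_prime p_ge7.
have bc := rising_coef12_dvd p p_prime p_ge7.
have d := sum_pow_bernoulli p p_prime p_ge7.
have cd : \sum_(1 <= k < p) (k ^ 2)%:R^-1 = 0 :> 'Z_(p ^ 3) <->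
    (p%:Z ^+ 3 %| (\sum_(j < p) j ^ (p ^ 3 - p ^ 2 - 2))%N%:Z)%Z.
  rewrite harmonic2_Zp_sum_pow // pmulrn -PoszX -intr_Zp_eq0; first exact: rwP eqP.
  by rewrite (ltn_exp2l 0) ?prime_gt1.
rewrite PoszX; tfae.
- by move=> /ab /b.
- by move=> /b; rewrite bc => /c.
- by move=> /cd /d.
- by move=> /d /cd /c; rewrite -bc => /ab.
Qed.
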